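(* Let $M\neq\{0\}$ be an inside factorial monoid with base $Q$. Then $Q$ is linked to $M$. In particular, $M=\operatorname{Ap}(M,Q)+\langle Q\rangle$.
   Context: All monoids are additive, commutative, cancellative and reduced (the only unit is $0$). $\mathbb N$ denotes the nonnegative integers. For $a,b\in M$, $a\le_M b$ means $b=a+c$ for some $c\in M$. An atom of a monoid is a nonzero element that is not a sum of two nonzero elements of it. A monoid is factorial if every element is a sum of atoms in a unique way up to order. $\langle Q\rangle$ is the submonoid generated by $Q$; $\operatorname{Ap}(M,Q)=M\setminus(Q+M)$; $X+Y=\{x+y\mid x\in X,y\in Y\}$. $M$ is inside factorial if there is a factorial submonoid $S\subseteq M$ such that for each $x\in M\setminus\{0\}$ there is a positive integer $m$ with $mx\in S$; the set of atoms of $S$ is then called a base of $M$. A non-empty subset $Q$ of $M$ is linked to $M$ if for each $x\in M\setminus\{0\}$ there exists $c(x)\in\mathbb N$ such that whenever $\sum_{q\in Q}\lambda_q q\le_M x$ with $\lambda_q\in\mathbb N$ (all but finitely many zero), one has $\sum_{q\in Q}\lambda_q\le c(x)$. *)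

(* Defs.v *)
From mathcomp Require Import all_boot all_algebra.
From mathcomp Require Import finmap.
From mathcomp Require Import boolp classical_sets.

Set Implicit Arguments.
Unset Strict Implicit.
Unset Printing Implicit Defensive.

Import GRing.Theory.

Local Open Scope classical_set_scope.
Local Open Scope ring_scope.

Section Monoids.
Variable M : nmodType.
Implicit Types (a b x y : M) (S Q X Y : set M).

Definition cancellative : Prop := forall a x y, a + x = a + y -> x = y.

Definition reduced : Prop := forall x, (exists y, x + y = 0) -> x = 0.

Definition mle a b : Prop := exists c, b = a + c.

Definition submonoid S : Prop := S 0 /\ (forall x y, S x -> S y -> S (x + y)).

Definition generated Q : set M := smallest submonoid Q.

Definition addset X Y : set M := [set x + y | x in X & y in Y].

Definition Ap Q : set M := setT `\` addset Q setT.

(* The atoms and the factoriality of a submonoid are relative to the submonoid: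
   an atom of [S] may be decomposable in [M]. *)
Definition atoms S : set M :=
  [set a | [/\ S a, a <> 0 &
    ~ exists x y, [/\ S x, S y, x <> 0, y <> 0 & a = x + y]]].

Definition factorization S x (s : seq M) : Prop :=
  (forall a, a \in s -> atoms S a) /\ x = \sum_(a <- s) a.

Definition factorial S : Prop :=
  forall x, S x ->
    (exists s, factorization S x s) /\
    (forall s t, factorization S x s -> factorization S x t -> perm_eq s t).

Definition inside_factorial_via S : Prop :=
  [/\ submonoid S, factorial S &
      forall x, x <> 0 -> exists2 m : nat, (0 < m)%N & S (x *+ m)].

Definition inside_factorial : Prop := exists S, inside_factorial_via S.

Definition is_base Q : Prop :=
  exists2 S, inside_factorial_via S & Q = atoms S.

(* A family of nonnegative integers indexed by [Q] with finitely many nonzero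
   members is a finitely supported function on [M] whose support lies in [Q]. *)
Definition linked Q : Prop :=
  Q !=set0 /\
  forall x, x <> 0 -> exists c : nat,
    forall l : {fsfun M -> nat with 0%N},
      (forall q, q \in finsupp l -> Q q) ->
      mle (\sum_(q <- finsupp l) q *+ l q) x ->
      (\sum_(q <- finsupp l) l q <= c)%N.

End Monoids.

Arguments cancellative M : clear implicits.
Arguments reduced M : clear implicits.
Arguments inside_factorial M : clear implicits.

(* Main.v *)
Require Import Defs.
From mathcomp Require Import all_boot all_algebra.
From mathcomp Require Import finmap.
From mathcomp Require Import boolp classical_sets.

(** Multiplying a divisibility relation into the factorial submonoid [S] makes
    lengths of factorizations comparable.  Given [x], choose [m > 0] with
    [m x] in [S] and let [c] be the length of its factorization.  If
    [x = q1 + ... + qk + y] with atoms [qi] of [S], choose [n > 0] with [n y] in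
    [S].  Then [nm x] has one factorization of length [n c], and another one of
    length at least [nm k], made of [nm] copies of [q1, ..., qk] and a
    factorization of [m (n y)].  Uniqueness gives [nm k <= n c], hence [k <= c],
    a bound that depends neither on [y] nor on [n]: this is
    [atoms_length_bounded].

    The decomposition of [M] follows from such bounds alone
    ([length_bounded_decomposition]): split off from [x] a longest possible sum
    of elements of [Q]; by maximality the remainder lies in [Ap Q]. *)

Set Implicit Arguments.
Unset Strict Implicit.
Unset Printing Implicit Defensive.

Import GRing.Theory.

Local Open Scope classical_set_scope.
Local Open Scope ring_scope.

(** Linkedness with the finitely supported families replaced by sequences with
    repetition, which can be concatenated and extended by one element.  A
    bound is also required at [x = 0], since [0] has to be decomposed too. *)
Definition length_bounded (M : nmodType) (Q : set M) : Prop :=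
  forall x : M, exists c : nat, forall t : seq M,
    (forall q, q \in t -> Q q) -> mle (\sum_(q <- t) q) x -> (size t <= c)%N.

Lemma factorization_cat (M : nmodType) (S : set M) (x y : M) (s t : seq M) :
  factorization S x s -> factorization S y t ->
  factorization S (x + y) (s ++ t).
Proof.
move=> [sS ->] [tS ->]; split; last by rewrite big_cat.
by move=> a; rewrite mem_cat => /orP[/sS|/tS].
Qed.

Lemma factorization_mulrn (M : nmodType) (S : set M) (x : M) (s : seq M)
    (n : nat) :
  factorization S x s -> factorization S (x *+ n) (flatten (nseq n s)).
Proof.
move=> xs; elim: n => [|n IHn]; first by split; rewrite ?big_nil.
by rewrite mulrS; apply: factorization_cat.
Qed.

Lemma size_flatten_nseq (T : Type) (n : nat) (s : seq T) :
  size (flatten (nseq n s)) = (n * size s)%N.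
Proof. by elim: n => //= n IHn; rewrite size_cat IHn mulSn. Qed.

Lemma submonoid_mulrn (M : nmodType) (S : set M) (x : M) (n : nat) :
  submonoid S -> S x -> S (x *+ n).
Proof.
move=> [S0 SD] Sx; elim: n => // n IHn.
by rewrite mulrS; apply: SD.
Qed.

Lemma inside_factorial_multiple (M : nmodType) (S : set M) (x : M) :
  inside_factorial_via S -> exists2 m : nat, (0 < m)%N & S (x *+ m).
Proof.
move=> [[S0 _] _ Smul]; have [->|/Smul//] := pselect (x = 0).
by exists 1%N.
Qed.

Lemma atoms_length_bounded (M : nmodType) (S : set M) :
  inside_factorial_via S -> length_bounded (atoms S).
Proof.
move=> Sif x; have [subS facS _] := Sif.
have [m m_gt0 Sxm] := inside_factorial_multiple x Sif.
have [[s xs] _] := facS _ Sxm; exists (size s) => t tS [y xE].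
have [n n_gt0 Syn] := inside_factorial_multiple y Sif.
have Synm := submonoid_mulrn m subS Syn.
have [[u yu] _] := facS _ Synm.
have ts : factorization S (\sum_(q <- t) q) t by [].
have xnm_t := factorization_cat (factorization_mulrn (m * n) ts) yu.
have xnm_s := factorization_mulrn n xs.
have xnmE : x *+ m *+ n = (\sum_(q <- t) q) *+ (m * n) + y *+ n *+ m.
  by rewrite xE -!mulrnA mulrnDl [(n * m)%N]mulnC.
rewrite -xnmE in xnm_t.
have [_ uniq_fac] := facS _ (submonoid_mulrn n subS Sxm).
have /perm_size := uniq_fac _ _ xnm_s xnm_t.
rewrite size_cat !size_flatten_nseq => sizeE.
rewrite -(leq_pmul2l n_gt0) sizeE.
apply: leq_trans (leq_addr _ _).
by rewrite leq_mul2r leq_pmull ?orbT.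
Qed.

(** Reducedness enters here: a positive multiple of a nonzero element is
    nonzero, so its factorization is not the empty one. *)
Lemma atoms_nonempty (M : nmodType) (S : set M) (x : M) :
  reduced M -> inside_factorial_via S -> x <> 0 -> atoms S !=set0.
Proof.
move=> redM [_ facS Smul] x0; have [[//|m] _ Sxm] := Smul x x0.
have [[[|a s] [sS xmE]] _] := facS _ Sxm.
  by case: x0; apply: redM; exists (x *+ m); rewrite -mulrS xmE big_nil.
by exists a; apply: sS; rewrite mem_head.
Qed.

Lemma length_bounded_linked (M : nmodType) (Q : set M) :
  Q !=set0 -> length_bounded Q -> linked Q.
Proof.
move=> Q0 bQ; split=> // x _; have [c cP] := bQ x; exists c => l lQ lx.
(* The sequence in which each [q] is repeated [l q] times. *)
pose t := flatten [seq nseq (l q) q | q <- finsupp l].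
have -> : (\sum_(q <- finsupp l) l q)%N = size t.
  rewrite size_flatten /shape -map_comp sumnE big_map.
  by apply: eq_bigr => q _; rewrite /= size_nseq.
apply: cP => [q /flatten_mapP[p pl]|].
  by rewrite mem_nseq => /andP[_ /eqP ->]; apply: lQ.
rewrite big_flatten big_map.
by under eq_bigr do rewrite big_nseq -Monoid.iteropE.
Qed.

Lemma generated_sum (M : nmodType) (Q : set M) (t : seq M) :
  (forall q, q \in t -> Q q) -> generated Q (\sum_(q <- t) q).
Proof.
move=> tQ A [[A0 AD] QA]; rewrite big_seq.
by apply: big_ind => // q /tQ; apply: QA.
Qed.

Lemma length_bounded_decomposition (M : nmodType) (Q : set M) :
  length_bounded Q -> [set: M] = addset (Ap Q) (generated Q).
Proof.
move=> bQ; apply/esym; rewrite -subTset => x _.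
have [c cP] := bQ x.
(* The numbers of elements of [Q] that can be split off from [x]. *)
pose P k := `[< exists t, [/\ forall q, q \in t -> Q q,
  mle (\sum_(q <- t) q) x & size t = k] >].
have P0 : exists k, P k.
  exists 0%N; apply/asboolP; exists [::].
  by split=> //; exists x; rewrite big_nil add0r.
have Pc k : P k -> (k <= c)%N by move=> /asboolP[t [tQ tx <-]]; apply: cP.
have [k /asboolP[t [tQ [y xE] sz_t]] kmax] := ex_maxnP P0 Pc.
exists y; last by exists (\sum_(q <- t) q); [exact: generated_sum|rewrite addrC].
(* An element [q] of [Q] dividing [y] would extend the longest sequence [t]. *)
split=> // -[q Qq [z _ yE]].
suff /kmax : P k.+1 by rewrite ltnn.
apply/asboolP; exists (q :: t); split; last by rewrite /= sz_t.
  by move=> p; rewrite inE => /predU1P[->|/tQ].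
by exists z; rewrite big_cons xE -yE addrCA addrA.
Qed.

Theorem corollary21 (M : nmodType) (Q : set M)
  (hcancel : cancellative M) (hreduced : reduced M)
  (hM : exists x : M, x <> 0)
  (hfact : inside_factorial M) (hQ : is_base Q) :
  linked Q /\ [set: M] = addset (Ap Q) (generated Q).
Proof.
have [S Sif ->] := hQ; have [x x0] := hM.
have bQ := atoms_length_bounded Sif; split.
  exact: length_bounded_linked (atoms_nonempty hreduced Sif x0) bQ.
exact: length_bounded_decomposition.
Qed.
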